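(* Let $M=r^a$ where $r$ is a prime and $a\geq 1$, and let $q$ be a prime power with $(q,M)=1$. Let $\alpha\in\mathrm{GL}(n,q)$ with combinatorial data $\Delta_\alpha$ consisting of polynomials $f_i\in\Phi$ of degree $d_i$ and partitions $\lambda_{f_i}=1^{m_1(\lambda_{f_i})}\cdots j^{m_j(\lambda_{f_i})}\cdots$, $1\leq i\leq l$. Then $X^M=\alpha$ has a solution in $\mathrm{GL}(n,q)$ if and only if for each $1\leq i\leq l$ one of the following holds: (1) $f_i\in\Phi^M$; (2) $f_i\in\Phi_{M,b}$ for some $b$ with $1\leq b\leq a$, and $r^b\mid m_j(\lambda_{f_i})$ for all $j$.
   Context: $\mathrm{GL}(n,q)$ is the group of invertible $n\times n$ matrices over the field $\mathbb F_q$ with $q$ elements. $\Phi$ is the set of monic irreducible polynomials of degree $\geq 1$ over $\mathbb F_q$ other than $x$. The conjugacy class of $\alpha\in\mathrm{GL}(n,q)$ is determined by its combinatorial data $\Delta_\alpha$: distinct $f_1,\dots,f_l\in\Phi$ with non-empty partitions $\lambda_{f_i}=(\lambda_{i_1},\lambda_{i_2},\dots)$ satisfying $\sum_i|\lambda_{f_i}|\deg f_i=n$, meaning that the $\mathbb F_q[x]$-module $\mathbb F_q^n$ defined by $\alpha$ is isomorphic to $\bigoplus_{i,j}\mathbb F_q[x]/(f_i^{\lambda_{i_j}})$. $m_j(\lambda)$ is the number of parts of $\lambda$ equal to $j$. $\Phi^M$ is the set of $f\in\Phi$ such that $f(x^M)$ has an irreducible factor of degree $\deg f$. For $1\leq b\leq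 a$, $\Phi_{M,b}$ is the set of $f\in\Phi$ such that $f(x^M)$ has $r^{a-b}$ irreducible factors, each of degree $r^b\deg f$. *)

(* Defs.v *)
From HB Require Import structures.
From mathcomp Require Import all_boot all_order all_fingroup all_algebra.

Set Implicit Arguments.
Unset Strict Implicit.
Unset Printing Implicit Defensive.

Import GRing.Theory.
Local Open Scope ring_scope.

Definition deg (R : nzRingType) (p : {poly R}) : nat := (size p).-1.

Definition in_Phi (F : fieldType) (f : {poly F}) : Prop :=
  [/\ f \is monic, irreducible_poly f & f != 'X].

(* f \Po 'X^M is f(x^M). *)
Definition in_Phi_pow (F : fieldType) (M : nat) (f : {poly F}) : Prop :=
  in_Phi f /\
  exists g : {poly F},
    [/\ irreducible_poly g, g %| f \Po 'X^M & deg g = deg f].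

(* Irreducible factors are counted up to associates, hence as monic ones:
   s enumerates the monic irreducible factors of f(x^(r^a)). *)
Definition in_Phi_split (F : fieldType) (r a b : nat) (f : {poly F}) : Prop :=
  in_Phi f /\
  exists s : seq {poly F},
    [/\ uniq s,
        forall g : {poly F},
          g \in s <->
          [/\ g \is monic, irreducible_poly g & g %| f \Po 'X^(r ^ a)],
        size s = (r ^ (a - b))%N
      & forall g : {poly F}, g \in s -> deg g = (r ^ b * deg f)%N].

Definition is_partition (lam : seq nat) : bool :=
  sorted geq lam && all (fun part => (0 < part)%N) lam.

Definition mult (j : nat) (lam : seq nat) : nat := count_mem j lam.

(* F^n is the space of column vectors, on which p in F[x] acts by p(A). The
   direct sum of the F[x]/(h k) is the type of dependent finite functions; its
   operations are componentwise, and p acts on F[x]/(h k) as multiplication by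
   the class of p. {poly %/ h k} is F[x]/(h k) only if h k is monic and
   nonconstant, which holds in the use below. *)
Definition polymod_isom (F : fieldType) (n : nat) (A : 'M[F]_n.+1)
    (K : finType) (h : K -> {poly F})
    (phi : 'cV[F]_n.+1 -> {dffun forall k : K, {poly %/ h k}}) : Prop :=
  [/\ bijective phi,
      forall u v k, phi (u + v) k = phi u k + phi v k
    & forall (p : {poly F}) v k,
        phi (horner_mx A p *m v) k = in_qpoly (h k) p * phi v k].

(* The summands are indexed by the pairs (i, j), j < size (lam i), where the
   part lam_(i, j) is nth 0 (lam i) j. *)
Definition combinatorial_data (F : finFieldType) (n : nat)
    (alpha : {'GL_n[F]}) (l : nat) (f : 'I_l -> {poly F})
    (lam : 'I_l -> seq nat) : Prop :=
  [/\ injective f,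
      forall i, in_Phi (f i),
      forall i, is_partition (lam i) /\ lam i <> [::],
      (\sum_(i < l) sumn (lam i) * deg (f i))%N = n
    & exists phi : 'cV[F]_n.-1.+1 ->
        {dffun forall k : {i : 'I_l & 'I_(size (lam i))},
           {poly %/ f (tag k) ^+ nth 0%N (lam (tag k)) (tagged k)}},
        polymod_isom (GLval alpha) phi].

(* Main.v *)
Require Import Defs.
From HB Require Import structures.
From mathcomp Require Import all_boot all_order all_fingroup all_algebra.
From mathcomp Require Import all_solvable all_field mxabelem zify.

Set Implicit Arguments.
Unset Strict Implicit.
Unset Printing Implicit Defensive.

Import GRing.Theory.
Local Open Scope ring_scope.

Local Notation "p ^%:A" := (map_poly (in_alg _) p) (at level 2) : ring_scope.

(** Write M = r^a, A for the matrix of alpha and V for the F[x]-module F^n on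
    which x acts by A. A matrix X with X^M = A makes V an F[y]-module on which
    x acts as y^M, so everything rests on the irreducible factors g of f(x^M)
    for f in Phi.

    These factors all have the same degree unless one of them has degree deg f
    (factor_degree_le): if y is a root of f(x^M) whose multiplicative order is
    divisible by M, the powers of y contain all M-th roots of unity, so F(y)
    contains every M-th root of y^M; otherwise the order of y^M is prime to r
    and y^M has an M-th root in F(y^M), whose minimal polynomial over F is a
    factor of degree deg f. Since f(x^M) is squarefree of degree
    M deg f, a common degree must be r^b deg f, shared by r^(a-b) factors.
    Hence each f in Phi lies in Phi^M or in some Phi_(M,b) with 1 <= b <= a
    (power_or_split).

    Necessity. If X^M = A and f = f_i lies in Phi_(M,b), the kernel of f(A)^j is
    the kernel of p(X) for p = f(x^M)^j, and all irreducible factors of p have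
    degree r^b deg f. The characteristic polynomial of X on this kernel divides
    a power of p, so r^b deg f divides the dimension of the kernel
    (dvdn_corank). By the module decomposition this dimension is
    deg f * sum_e min(j, e), over the parts e of lambda_f (corank_polymod).
    Taking differences over j twice gives r^b | m_j(lambda_f)
    (dvdn_mult_parts).

    Sufficiency. Let g be a factor of f(x^M) of degree c deg f, with c = 1 in
    case (1) and c = r^b in case (2). Then F[y]/(g^e), with x acting as y^M, is
    free over F[x]/(f^e) with basis 1, y, .., y^(c-1). The matrix of
    multiplication by y in this basis is a matrix C of polynomials with
    C^M = x modulo f^e (root_matrix). As c divides the number of summands
    F[x]/(f^e) of V, they can be grouped c at a time, and blocks C on the groups
    make a matrix S with S^M = x on the whole of V (block_root_matrix), which
    acts on V as the required X (polymod_root). *)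

(** * Factorization over a finite field *)

Lemma dvdp_sum (F : fieldType) (I : finType)
    (d : {poly F}) (p : I -> {poly F}) :
  (forall i, d %| p i) -> d %| \sum_i p i.
Proof.
by move=> dp; apply: (big_ind (dvdp d)) => //; exact: dvdp_add.
Qed.

Lemma irreducible_deg_gt0 (F : fieldType) (f : {poly F}) :
  irreducible_poly f -> (0 < deg f)%N.
Proof. by case=> f_gt1 _; rewrite /deg -subn1 subn_gt0. Qed.

Lemma deg_prod_monic (R : idomainType) (s : seq {poly R}) :
  (forall g, g \in s -> g \is monic) ->
  deg (\prod_(g <- s) g) = (\sum_(g <- s) deg g)%N.
Proof.
elim: s => [|g s IHs] mon_s; first by rewrite !big_nil /deg size_poly1.
have mon_tl h : h \in s -> h \is monic.
  by move=> hs; rewrite mon_s ?inE ?hs ?orbT.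
have nz_g : g != 0 by rewrite monic_neq0 // mon_s ?mem_head.
have nz_p : \prod_(h <- s) h != 0.
  by rewrite monic_neq0 // big_seq monic_prod.
rewrite !big_cons -IHs // /deg size_mul //.
move: nz_g nz_p; rewrite -!size_poly_gt0; do 2!case: (size _) => // ?.
by rewrite addnS.
Qed.

Lemma monic_factorization (F : finFieldType) (p : {poly F}) :
  p \is monic ->
  exists2 s : seq {poly F},
    forall g, g \in s -> g \is monic /\ irreducible_poly g
  & p = \prod_(g <- s) g.
Proof.
have [n] := ubnP (size p); elim: n p => // n IHn p le_pn mon_p.
have [/irreducibleP irr_p|] := boolP (irreducibleb p).
  by exists [:: p]; [move=> g /[1!inE]/eqP-> | rewrite big_seq1].
have [p1 _|p_gt1] := leqP (size p) 1.
  exists [::] => //; rewrite big_nil; apply/eqP.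
  rewrite -eqp_monic ?monic1 // -size_poly_eq1 eqn_leq p1.
  by rewrite size_poly_gt0 monic_neq0.
rewrite /irreducibleb p_gt1 /= negb_forall => /existsP[q].
rewrite negb_imply -ltnNge -Pdiv.Idomain.dvdpE => /andP[q_dvd q_gt1].
have nz_q : val q != 0 by rewrite -size_poly_gt0 ltnW.
have lt_qp : (size (val q) < size p)%N.
  by rewrite (leq_ltn_trans (size_npoly q)) // prednK // ltnW.
pose q1 := (lead_coef (val q))^-1 *: val q.
have nz_lc : (lead_coef (val q))^-1 != 0 by rewrite invr_eq0 lead_coef_eq0.
have mon_q1 : q1 \is monic by rewrite monicE lead_coefZ mulVf // lead_coef_eq0.
have size_q1 : size q1 = size (val q) by rewrite size_scale.
have p_eq : p = q1 * (p %/ q1) by rewrite mulrC divpK // dvdpZl.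
have mon_r : p %/ q1 \is monic by rewrite -(monicMl _ mon_q1) -p_eq.
have lt_rp : (size (p %/ q1)%R < size p)%N.
  rewrite size_divp ?monic_neq0 // size_q1 ltn_subrL (ltnW p_gt1) andbT.
  by rewrite -subn1 subn_gt0.
have [|s1 irr_s1 q1E] := IHn q1 _ mon_q1.
  by rewrite size_q1 (leq_trans lt_qp).
have [|s2 irr_s2 rE] := IHn _ _ mon_r; first by rewrite (leq_trans lt_rp).
exists (s1 ++ s2); last by rewrite big_cat /= -q1E -rE.
by move=> g; rewrite mem_cat => /orP[/irr_s1|/irr_s2].
Qed.

Lemma irreducible_dvd_prod (F : fieldType) (g : {poly F}) (s : seq {poly F}) :
  irreducible_poly g -> g %| \prod_(h <- s) h -> exists2 h, h \in s & g %| h.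
Proof.
move=> irr_g; elim: s => [|h s IHs]; rewrite ?big_nil ?big_cons.
  by rewrite dvdp1 => /eqP g1; have := irr_g.1; rewrite g1.
have [gh _|ngh] := boolP (g %| h); first by exists h; rewrite ?mem_head.
rewrite Gauss_dvdpr ?irreducible_poly_coprime //.
by case/IHs => k ks gk; exists k; rewrite // inE ks orbT.
Qed.

Lemma irreducible_dvd_exp (F : fieldType) (g p : {poly F}) m :
  irreducible_poly g -> g %| p ^+ m -> g %| p.
Proof.
move=> irr_g; apply: contraLR; rewrite -irreducible_poly_coprime //.
by move=> /(coprimep_expr m); rewrite irreducible_poly_coprime.
Qed.

Lemma monic_irreducible_eq (F : fieldType) (g h : {poly F}) :
  g \is monic -> h \is monic -> irreducible_poly g -> irreducible_poly h ->
  g %| h -> g = h.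
Proof.
move=> mon_g mon_h irr_g irr_h gh; apply/eqP; rewrite -eqp_monic //.
by apply: irr_h.2 => //; rewrite neq_ltn irr_g.1 orbT.
Qed.

(** Separability makes the factorization squarefree, so the list of factors has
    no repetition and its size counts the irreducible factors. *)
Lemma monic_irreducible_factors (F : finFieldType) (p : {poly F}) :
  p \is monic -> separable_poly p ->
  exists s : seq {poly F},
    [/\ uniq s,
        forall g, g \in s <-> [/\ g \is monic, irreducible_poly g & g %| p]
      & p = \prod_(g <- s) g].
Proof.
move=> mon_p sep_p; have [s irr_s pE] := monic_factorization mon_p.
exists s; split=> // [|g].
  have: separable_poly (\prod_(g <- s) g) by rewrite -pE.
  elim: s irr_s {pE} => //= g s IHs irr_gs; rewrite big_cons separable_mul.
  case/and3P=> _ sep_s co_gs.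
  have irr_s h : h \in s -> h \is monic /\ irreducible_poly h.
    by move=> hs; apply: irr_gs; rewrite inE hs orbT.
  rewrite IHs // andbT; apply/negP => gs.
  have g_prod : g %| \prod_(h <- s) h by rewrite (big_rem _ gs) dvdp_mulr.
  have := coprimep_dvdl g_prod co_gs; rewrite coprimepp => /eqP g1.
  by have [_ [g_gt1 _]] := irr_gs g (mem_head _ _); rewrite g1 in g_gt1.
split=> [gs|[mon_g irr_g]]; last first.
  rewrite pE => /(irreducible_dvd_prod irr_g)[h hs gh].
  have [mon_h irr_h] := irr_s h hs.
  by rewrite (monic_irreducible_eq mon_g mon_h).
have [mon_g irr_g] := irr_s g gs; split=> //.
by rewrite pE (big_rem _ gs) /= dvdp_mulr.
Qed.

Lemma dvdn_deg_factors (F : finFieldType) (p : {poly F}) D :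
  p \is monic ->
  (forall g, g \is monic -> irreducible_poly g -> g %| p -> (D %| deg g)%N) ->
  (D %| deg p)%N.
Proof.
move=> mon_p D_p; have [s irr_s pE] := monic_factorization mon_p.
rewrite pE deg_prod_monic => [|g /irr_s[]//].
rewrite big_seq dvdn_sum // => g gs; have [mon_g irr_g] := irr_s g gs.
apply: D_p => //.
by rewrite pE (big_rem _ gs) dvdp_mulr.
Qed.

(** The characteristic of F divides #|F|, hence not M. *)
Lemma natr_neq0_coprime (F : finFieldType) (M : nat) :
  coprime #|F| M -> M%:R != 0 :> F.
Proof.
have [p p_pr charFp] := finPcharP F.
apply: contraTneq => /eqP; rewrite -(dvdn_pcharf charFp) => pM.
have pF : (p %| #|F|)%N.
  have := expg_cardG (in_setT (1 : F)).
  by rewrite FinRing.zmodXgE cardsT => /eqP; rewrite -(dvdn_pcharf charFp).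
apply/negP => /(coprime_dvdl pF)/(coprime_dvdr pM).
by rewrite /coprime gcdnn => /eqP p1; rewrite p1 in p_pr.
Qed.

(** * Roots in finite extensions *)

(** One extension in which every nonconstant divisor of p has a root, so that
    roots of different factors of p can be compared. *)
Lemma splitting_roots (F : finFieldType) (p : {poly F}) : p != 0 ->
  exists L : splittingFieldType F, forall g : {poly F},
    g %| p -> (1 < size g)%N -> exists x : L, root g^%:A x.
Proof.
move=> nz_p; have [L [rs eq_p _]] := FinSplittingFieldFor nz_p.
exists L => g gp g_gt1.
have : (g^%:A : {poly L}) %| \prod_(z <- rs) ('X - z%:P).
  by rewrite -(eqp_dvdr _ eq_p) dvdp_map.
case/dvdp_prod_XsubC => m rE.
have : size (g^%:A : {poly L}) != 1%N by rewrite size_map_poly gtn_eqF.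
rewrite (eqp_size rE) size_prod_XsubC.
case: (mask m rs) rE => // x rs1 rE _.
by exists x; rewrite (eqp_root rE) root_prod_XsubC mem_head.
Qed.

Lemma irreducible_minPoly (F : fieldType) (L : fieldExtType F)
    (g : {poly F}) (x : L) :
  irreducible_poly g -> root g^%:A x -> minPoly 1 x %= g^%:A.
Proof.
move=> irr_g gx0.
have /polyOver1P[h minE] := minPolyOver 1 x.
have : minPoly 1 x %| g^%:A by rewrite minPoly_dvdp // alg_polyOver.
rewrite minE dvdp_map eqp_map => /irr_g.2 -> //.
by rewrite -(size_map_poly (in_alg L)) -minE size_minPoly.
Qed.

(** Degrees of irreducible polynomials are read off as dimensions of simple
    extensions, where inclusions give inequalities and divisibilities. *)
Lemma dim_adjoin_root (F : fieldType) (L : fieldExtType F)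
    (g : {poly F}) (x : L) :
  irreducible_poly g -> root g^%:A x -> \dim <<1; x>> = deg g.
Proof.
move=> irr_g /(irreducible_minPoly irr_g)/eqp_size.
rewrite size_minPoly size_map_poly dim_Fadjoin dimv1 muln1 /deg => <- //.
Qed.

(** An extension of finite fields is Galois, so the minimal polynomial of a
    root of f is separable. *)
Lemma irreducible_separable (F : finFieldType) (f : {poly F}) :
  irreducible_poly f -> separable_poly f.
Proof.
move=> irr_f; have [L rootL] := splitting_roots (irredp_neq0 irr_f).
have [x fx0] := rootL f (dvdpp f) irr_f.1.
rewrite -(separable_map (in_alg L)).
rewrite -(eqp_separable (irreducible_minPoly irr_f fx0)).
have /and3P[_ /separableP sepL _] := finField_galois (sub1v {:L}).
exact: sepL (memvf x).
Qed.

Lemma conjugate_root (F : finFieldType) (L : splittingFieldType F)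
    (g : {poly F}) (x y : L) :
  irreducible_poly g -> root g^%:A x -> root g^%:A y ->
  exists s : gal_of {:L}, s y = x.
Proof.
move=> irr_g gx gy.
have [||s _ sy] :=
  @normalField_root_minPoly F L 1%AS {:L}%AS y x (sub1v _) _ (memvf y).
- exact: normalFieldf.
- by rewrite (eqp_root (irreducible_minPoly irr_g gy)).
by exists s.
Qed.

Lemma gal_root (F : finFieldType) (L : splittingFieldType F)
    (s : gal_of {:L}) (g : {poly F}) (x : L) :
  root g^%:A x -> root g^%:A (s x).
Proof.
move=> gx.
have sA c : s c%:A = c%:A by rewrite linearZ rmorph1.
have <- : map_poly s g^%:A = g^%:A.
  by rewrite -map_poly_comp; apply: eq_map_poly => c /=; apply: sA.
by rewrite fmorph_root.
Qed.

Lemma unity_power (F : finFieldType) (L : fieldExtType F) (x : L) :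
  x != 0 -> exists2 N, (0 < N)%N & x ^+ N = 1.
Proof.
move=> nzx; have /= xc := expf_card (x : finvect_type L).
have L_gt1 : (1 < #|finvect_type L|)%N := finNzRing_gt1 _.
exists (#|finvect_type L|.-1); first by rewrite -subn1 subn_gt0.
apply: (mulfI nzx); rewrite -exprS prednK ?mulr1 //; exact: ltnW.
Qed.

(** * The irreducible factors of f(x^M) *)

Lemma in_Phi_root0 (F : fieldType) (f : {poly F}) : in_Phi f -> ~~ root f 0.
Proof.
case=> mon_f irr_f; apply: contraNN => f0.
rewrite -eqp_monic ?monicX // eqp_sym irr_f.2 ?size_polyX //.
by move: f0; rewrite -dvdp_XsubCl subr0.
Qed.

Lemma deg_comp_Xn (R : idomainType) (M : nat) (f : {poly R}) :
  deg (f \Po 'X^M) = (deg f * M)%N.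
Proof. by rewrite /deg size_comp_poly size_polyXn. Qed.

Lemma monic_comp_Xn (R : idomainType) (M : nat) (f : {poly R}) : (0 < M)%N ->
  f \is monic -> f \Po 'X^M \is monic.
Proof.
move=> M_gt0 mon_f.
by rewrite monicE lead_coef_comp ?size_polyXn ?ltnS // lead_coefXn expr1n mulr1.
Qed.

Lemma root_comp_Xn (F : fieldType) (L : fieldExtType F) (M : nat)
    (f : {poly F}) (x : L) :
  root (f \Po 'X^M)^%:A x = root f^%:A (x ^+ M).
Proof. by rewrite map_comp_poly map_polyXn /root horner_comp hornerXn. Qed.

(** The derivative of f(x^M) is M f'(x^M) x^(M-1), and f(x^M) is coprime to each
    factor: to f'(x^M) because f is separable, to x because f(0) is nonzero. *)
Lemma separable_comp_Xn (F : finFieldType) (M : nat) (f : {poly F}) :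
  M%:R != 0 :> F -> irreducible_poly f -> ~~ root f 0 ->
  separable_poly (f \Po 'X^M).
Proof.
move=> nzM irr_f f0.
have M_gt0 : (0 < M)%N by case: (M) nzM; rewrite ?eqxx.
rewrite unlock deriv_comp derivXn coprimepMr.
rewrite coprimep_comp_poly; last first.
  by have := irreducible_separable irr_f; rewrite unlock.
rewrite -scaler_nat coprimepZr // coprimep_expr //.
rewrite coprimepX /root horner_comp hornerXn.
by rewrite expr0n eqn0Ngt M_gt0.
Qed.

(** Let o be the order of x. If r^a divides o, then x^(o / r^a) is a primitive
    root of unity of order r^a. Otherwise o = m r^z with z < a and m prime to r,
    so x^(r^a) has order dividing m and raising to the power r^a is invertible
    on its powers. *)
Lemma unity_root_dichotomy (F : finFieldType) (L : fieldExtType F) 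
    (r a : nat) (x : L) :
  prime r -> x != 0 ->
  (exists y, (r ^ a).-primitive_root (x ^+ y)) \/
  (exists y, x ^+ (r ^ a) = ((x ^+ (r ^ a)) ^+ y) ^+ (r ^ a)).
Proof.
move=> r_prime nzx; have [N N_gt0 xN] := unity_power nzx.
have [o prim_x _] := prim_order_exists N_gt0 xN.
have o_gt0 := prim_order_gt0 prim_x.
have ra_gt0 : (0 < r ^ a)%N by rewrite expn_gt0 prime_gt0.
have [ra_o|n_ra_o] := boolP (r ^ a %| o)%N.
  by left; exists (o %/ r ^ a)%N; apply: dvdn_prim_root.
right.
have z_a : (logn r o <= a)%N.
  by rewrite leqNgt; apply: contra n_ra_o => /ltnW; rewrite -pfactor_dvdn.
have [m co_rm oE] := pfactor_coprime r_prime o_gt0.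
have xm : (x ^+ (r ^ a)) ^+ m = 1.
  rewrite -exprM -(subnK z_a) expnD -mulnA [(_ * m)%N]mulnC -oE mulnC exprM.
  by rewrite (prim_expr_order prim_x) expr1n.
have [u v uv _] := egcdnP m ra_gt0.
exists u; rewrite -exprM uv.
have -> : gcdn (r ^ a) m = 1%N by apply/eqP; rewrite -/(coprime _ _) coprimeXl.
by rewrite exprD expr1 mulnC exprM xm expr1n mul1r.
Qed.

(** A Galois automorphism moves x' so that x and x' have the same M-th power,
    where M = r^a; their quotient is then an M-th root of unity. When this root
    lies in F(x), so does x', whence the comparison of degrees. *)
Lemma factor_degree_le (F : finFieldType) (L : splittingFieldType F)
    (r a : nat) (f g g' : {poly F}) (x x' : L) :
  prime r -> irreducible_poly f -> ~~ root f 0 ->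
  irreducible_poly g -> irreducible_poly g' ->
  g %| f \Po 'X^(r ^ a) -> g' %| f \Po 'X^(r ^ a) ->
  root g^%:A x -> root g'^%:A x' ->
  (exists y : L, root (f \Po 'X^(r ^ a))^%:A y /\ \dim <<1; y>> = deg f)
  \/ (deg g' <= deg g)%N.
Proof.
set M := (r ^ a)%N => r_pr irr_f f0 irr_g irr_g' gf g'f gx g'x'.
have rootP h y : h %| f \Po 'X^M -> root h^%:A y -> root f^%:A (y ^+ M : L).
  move=> hf hy; rewrite -root_comp_Xn.
  by move: hf; rewrite -(dvdp_map (in_alg L)) => /root_dvdp; apply.
have M_gt0 : (0 < M)%N by rewrite expn_gt0 prime_gt0.
have nzx : x != 0.
  apply: contraNneq f0 => x0; move: (rootP g x gf gx).
  by rewrite x0 expr0n eqn0Ngt M_gt0 /= -(fmorph_root (in_alg L)) /= scale0r.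
(* If a power of x is a primitive M-th root of unity, every M-th root of x ^+ M
   lies in F(x); otherwise x ^+ M already has an M-th root in F(x ^+ M). *)
have [[j prim_w]|[j zE]] := unity_root_dichotomy a r_pr nzx; [right | left].
  have [s sz] := conjugate_root irr_f (rootP g x gf gx) (rootP g' x' g'f g'x').
  have g'sx := gal_root s g'x'.
  have wM : (s x' / x) ^+ M = 1.
    by rewrite expr_div_n -rmorphXn /= sz divff ?expf_neq0.
  have [k wE] := prim_rootP prim_w wM.
  rewrite -(dim_adjoin_root irr_g gx) -(dim_adjoin_root irr_g' g'sx).
  apply/dimvS/FadjoinP; split; first exact: sub1v.
  have -> : s x' = (x ^+ j) ^+ k * x by rewrite -wE divfK.
  by rewrite rpredM ?rpredX ?memv_adjoin.
exists ((x ^+ M) ^+ j); split; first by rewrite root_comp_Xn -zE (rootP g).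
rewrite -(dim_adjoin_root irr_f (rootP g x gf gx)).
apply/eqP; rewrite eqn_leq !dimvS //; apply/FadjoinP; split; rewrite ?sub1v //.
  by rewrite [X in X \in _]zE rpredX ?memv_adjoin.
by rewrite rpredX ?memv_adjoin.
Qed.

(** When no irreducible factor of f(x^M) has degree deg f, the inequality of
    factor_degree_le holds both ways and all of them have one degree e deg f.
    Counting degrees, e times their number is M = r^a, so e is a power of r. *)
Lemma power_or_split (F : finFieldType) (r a : nat) (f : {poly F}) :
  prime r -> coprime #|F| (r ^ a) -> in_Phi f ->
  in_Phi_pow (r ^ a) f \/
  exists b, (1 <= b <= a)%N /\ in_Phi_split r a b f.
Proof.
move=> r_pr co_q Phi_f; have [mon_f irr_f _] := Phi_f.
have f0 := in_Phi_root0 Phi_f.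
set M := (r ^ a)%N.
have M_gt0 : (0 < M)%N by rewrite expn_gt0 prime_gt0.
set fM := f \Po 'X^M.
have mon_fM : fM \is monic by rewrite monic_comp_Xn.
have sep_fM : separable_poly fM by rewrite separable_comp_Xn ?natr_neq0_coprime.
have [s [uniq_s sP fME]] := monic_irreducible_factors mon_fM sep_fM.
have [L rootL] := splitting_roots (monic_neq0 mon_fM).
have rootP g : g \in s -> exists x : L, root g^%:A x.
  by case/sP=> _ [g_gt1 _] gf; apply: rootL.
have deg_fM : (\sum_(g <- s) deg g = deg f * M)%N.
  by rewrite -deg_comp_Xn -/fM fME deg_prod_monic // => g /sP[].
have deg_f_gt0 := irreducible_deg_gt0 irr_f.
have [/hasP[g gs /eqP gd]|no_deg] := boolP (has (fun g => deg g == deg f) s).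
  by left; split=> //; exists g; have [_ irr_g gf] := (sP g).1 gs.
have deg_le g g' : g \in s -> g' \in s -> (deg g' <= deg g)%N.
  move=> gs g's; have [x gx] := rootP g gs; have [x' g'x'] := rootP g' g's.
  have [_ irr_g gf] := (sP g).1 gs; have [_ irr_g' g'f] := (sP g').1 g's.
  have [[y [fy dimy]]|//] :=
    factor_degree_le r_pr irr_f f0 irr_g irr_g' gf g'f gx g'x'.
  case/negP: no_deg.
  have [h hs hy] : exists2 h, h \in s & root h^%:A y.
    move: fy; rewrite -/M -/fM fME rmorph_prod /= /root horner_prod.
    by rewrite prodf_seq_eq0 => /hasP[h hs hy]; exists h.
  have [_ irr_h _] := (sP h).1 hs.
  by apply/hasP; exists h; rewrite // -(dim_adjoin_root irr_h hy) dimy.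
case: s => [|g s] in uniq_s sP fME rootP deg_fM no_deg deg_le *.
  by move: deg_fM; rewrite big_nil => /esym/eqP; rewrite muln_eq0 !gtn_eqF.
have deg_eq h : h \in g :: s -> deg h = deg g.
  by move=> hs; apply/eqP; rewrite eqn_leq !deg_le ?mem_head.
have [x gx] := rootP g (mem_head _ _).
have [_ irr_g gf] := (sP g).1 (mem_head _ _).
have fx : root f^%:A (x ^+ M).
  rewrite -root_comp_Xn.
  by move: gf; rewrite -(dvdp_map (in_alg L)) => /root_dvdp; apply.
have /dvdnP[e degE] : (deg f %| deg g)%N.
  rewrite -(dim_adjoin_root irr_f fx) -(dim_adjoin_root irr_g gx) field_dimS //.
  by apply/FadjoinP; rewrite sub1v rpredX ?memv_adjoin.
(* f(x^M) has degree M deg f and is the product of the factors in s. *)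
have e_size : (e * size (g :: s) = M)%N.
  apply/eqP; rewrite -(eqn_pmul2r deg_f_gt0) [X in _ == X]mulnC -deg_fM.
  rewrite mulnAC -degE big_seq (eq_bigr (fun=> deg g)) => [|h /deg_eq //].
  by rewrite -big_seq big_const_seq count_predT iter_addn_0.
have [b le_ba eE] : exists2 b, (b <= a)%N & e = (r ^ b)%N.
  by apply/dvdn_pfactor; rewrite // -/M -e_size dvdn_mulr.
right; exists b; split.
  rewrite le_ba andbT lt0n; apply: contraNneq no_deg => b0.
  by apply/hasP; exists g; rewrite ?mem_head // degE eE b0 mul1n.
split=> //; exists (g :: s).
split=> // [|h hs]; last by rewrite deg_eq // degE eE.
by rewrite expnB ?prime_gt0 // -eE -/M -e_size mulKn // eE expn_gt0 prime_gt0.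
Qed.

(** * F[y]/(g^e) as a free module over F[x]/(f^e) *)

(** The combination of 1, y, .., y^(c-1) with coefficients p i in F[x], where x
    acts as y^M. *)
Definition lincomb (F : fieldType) (M c : nat) (p : 'I_c -> {poly F}) :
  {poly F} :=
  \sum_(i < c) (p i \Po 'X^M) * 'X^i.

Lemma lincombB (F : fieldType) M c (p q : 'I_c -> {poly F}) :
  lincomb M (fun i => p i - q i) = lincomb M p - lincomb M q.
Proof.
by rewrite /lincomb -sumrB; apply: eq_bigr => i _; rewrite comp_polyB mulrBl.
Qed.

(** Freeness modulo g, which is the linear independence of 1, y, .., y^(c-1)
    over the subfield F(y^M): for a root y of g, F(y) has degree
    c deg f over F and F(y^M) has degree deg f, so y has degree c over
    F(y^M). *)
Lemma lincomb_dvd1 (F : finFieldType) (M c : nat) (f g : {poly F})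
    (p : 'I_c -> {poly F}) :
  irreducible_poly f -> irreducible_poly g ->
  g %| f \Po 'X^M -> deg g = (c * deg f)%N ->
  g %| lincomb M p -> forall i, f %| p i.
Proof.
move=> irr_f irr_g gf deg_g g_sum i.
have [L rootL] := splitting_roots (irredp_neq0 irr_g).
have [x gx] := rootL g (dvdpp g) irr_g.1.
have g_root h : g %| h -> root h^%:A x.
  by rewrite -(dvdp_map (in_alg L)) => /root_dvdp; apply.
have fz : root f^%:A (x ^+ M) by rewrite -root_comp_Xn g_root.
set z := x ^+ M in fz *.
pose a j := (p j)^%:A.[z].
pose P := \sum_(j < c) a j *: 'X^j.
have coefP (j : 'I_c) : P`_j = a j.
  rewrite coef_sum (bigD1 j) //= coefZ coefXn eqxx mulr1 big1 ?addr0 // => k kj.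
  by rewrite coefZ coefXn eq_sym (negPf (kj : (k : nat) != j)) mulr0.
have a_in j : a j \in <<1; z>>%VS by rewrite mempx_Fadjoin // alg_polyOver.
have Px : root P x.
  have := g_root _ g_sum; rewrite /root => /eqP <-; apply/eqP.
  rewrite rmorph_sum !horner_sum; apply: eq_bigr => j _ /=.
  rewrite rmorphM /= map_comp_poly !map_polyXn !hornerE horner_comp.
  by rewrite !hornerXn.
have PK : P \is a polyOver <<1; z>>%VS.
  by apply: rpred_sum => j _; rewrite polyOverZ ?rpredX ?polyOverX.
have le_c : (c <= adjoin_degree <<1; z>>%AS x)%N.
  rewrite -(leq_pmul2r (irreducible_deg_gt0 irr_f)) -deg_g.
  rewrite -(dim_adjoin_root irr_f fz) -dim_Fadjoin.
  rewrite -(dim_adjoin_root irr_g gx) dimvS //.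
  by apply/FadjoinP; rewrite sub1v memv_adjoin.
(* The minimal polynomial of x over F(z) is too long to divide P. *)
have P0 : P = 0.
  apply/eqP; apply: contraLR (minPoly_dvdp PK Px) => nzP.
  apply/negP => /(dvdp_leq nzP).
  rewrite size_minPoly leqNgt ltnS => /negP; apply.
  apply: leq_trans le_c; apply: leq_trans (size_sum _ _ _) _.
  apply/bigmax_leqP => j _; apply: leq_trans (size_scale_leq _ _) _.
  by rewrite size_polyXn.
rewrite -(dvdp_map (in_alg L)) -(eqp_dvdl _ (irreducible_minPoly irr_f fz)).
by rewrite minPoly_dvdp ?alg_polyOver // /root -/(a i) -coefP P0 coef0.
Qed.

(** Freeness modulo g^e. All p i are divisible by f by the case e = 1; since
    f(y^M) = g u with u prime to g (f(x^M) is squarefree), dividing them by f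
    lowers the exponent e by one. *)
Lemma lincomb_dvd (F : finFieldType) (M c e : nat) (f g : {poly F})
    (p : 'I_c -> {poly F}) :
  M%:R != 0 :> F -> irreducible_poly f -> ~~ root f 0 -> irreducible_poly g ->
  g %| f \Po 'X^M -> deg g = (c * deg f)%N ->
  g ^+ e %| lincomb M p -> forall i, f ^+ e %| p i.
Proof.
move=> nzM irr_f f0 irr_g gf deg_g.
elim: e p => [|e IHe] p g_sum i; first by rewrite dvd1p.
have fp j : f %| p j.
  apply: lincomb_dvd1 irr_f irr_g gf deg_g _ j.
  by apply: dvdp_trans g_sum; rewrite exprS dvdp_mulr.
have gE := divpK gf; set u := _ %/ g in gE.
have sumE : lincomb M p = g * (u * lincomb M (fun j => p j %/ f)).
  rewrite mulrA [g * u]mulrC gE /lincomb mulr_sumr; apply: eq_bigr => j _.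
  by rewrite mulrA -comp_polyM [f * _]mulrC divpK.
have co_gu : coprimep g u.
  have := separable_comp_Xn nzM irr_f f0; rewrite -gE separable_mul.
  by case/and3P=> _ _; rewrite coprimep_sym.
have g_rest : g ^+ e %| lincomb M (fun j => p j %/ f).
  rewrite -(Gauss_dvdpr _ (coprimep_expl e co_gu)).
  by rewrite -(dvdp_mul2l _ _ (irredp_neq0 irr_g)) -exprS -sumE.
have fe := IHe _ g_rest i; rewrite -(divpK (fp i)) exprSr.
exact: dvdp_mul fe (dvdpp f).
Qed.

(** Generation follows from freeness by counting: (F[x]/(f^e))^c and F[y]/(g^e)
    both have #|F|^(e deg g) elements. *)
Lemma lincomb_onto (F : finFieldType) (M c e : nat) (f g : {poly F}) :
  M%:R != 0 :> F -> irreducible_poly f -> ~~ root f 0 -> irreducible_poly g ->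
  g %| f \Po 'X^M -> deg g = (c * deg f)%N ->
  forall u, exists p : 'I_c -> {poly F}, g ^+ e %| lincomb M p - u.
Proof.
move=> nzM irr_f f0 irr_g gf deg_g u.
have size_exp (h : {poly F}) : irreducible_poly h ->
    size (h ^+ e) = (deg h * e).+1.
  move=> irr_h; rewrite /deg -size_exp prednK // size_poly_gt0 expf_neq0 //.
  exact: irredp_neq0.
have nz_ge : g ^+ e != 0 by rewrite expf_neq0 // irredp_neq0.
pose T := {ffun 'I_c -> {poly_(deg f * e) F}}.
pose theta (w : T) : {poly_(deg g * e) F} :=
  npolyp _ (lincomb M (fun i => w i : {poly F}) %% g ^+ e).
have small h : (size (h %% g ^+ e)%R <= deg g * e)%N.
  by rewrite -ltnS -(size_exp g irr_g) ltn_modp.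
have theta_inj : injective theta.
  move=> w w' /(congr1 val) /=; rewrite !npolypK // => eq_mod.
  apply/ffunP => i; apply/val_inj/eqP; rewrite -subr_eq0 /=.
  have : f ^+ e %| (w i : {poly F}) - w' i.
    apply: (lincomb_dvd (p := fun i => (w i : {poly F}) - w' i)
      nzM irr_f f0 irr_g gf deg_g).
    by rewrite lincombB /dvdp modpD modpN eq_mod subrr.
  apply: contraLR => nz; apply/negP => /(dvdp_leq nz).
  rewrite size_exp // leqNgt ltnS => /negP; apply.
  apply: leq_trans (size_polyD _ _) _; rewrite size_polyN geq_max.
  by rewrite !size_npoly.
have card_le : (#|{: {poly_(deg g * e) F}}| <= #|T|)%N.
  rewrite card_ffun !card_npoly card_ord -expnM.
  by rewrite deg_g -mulnA [(c * _)%N]mulnC.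
have /codomP[w uE] := inj_card_onto theta_inj card_le (npolyp _ (u %% g ^+ e)).
exists (fun i => w i : {poly F}).
move/(congr1 val): uE; rewrite /= !npolypK // => uE.
by rewrite /dvdp modpD modpN -uE subrr.
Qed.

(** With Y the column of basis vectors 1, y, .., y^(c-1), the matrix C satisfies
    y Y = C(y^M) Y modulo g^e. Hence y^M Y = C^M(y^M) Y, and freeness compares
    coefficients. *)
Lemma root_matrix (F : finFieldType) (M c e : nat) (f g : {poly F}) :
  M%:R != 0 :> F -> irreducible_poly f -> ~~ root f 0 -> irreducible_poly g ->
  g %| f \Po 'X^M -> deg g = (c * deg f)%N ->
  exists C : 'M[{poly F}]_c, forall i j, f ^+ e %| (C ^+ M - 'X%:M) i j.
Proof.
move=> nzM irr_f f0 irr_g gf deg_g.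
have onto := lincomb_onto e nzM irr_f f0 irr_g gf deg_g.
have [P PE] := fin_all_exists (fun i : 'I_c => onto ('X^(i.+1))).
(* Row i of C holds the coordinates of y ^+ i.+1, so C is the matrix of
   multiplication by y in the basis Y. *)
pose C := \matrix_(i, j) P i j.
pose comp (B : 'M[{poly F}]_c) := map_mx (comp_poly ('X^M : {poly F})) B.
pose Y : 'cV[{poly F}]_c := \col_i 'X^i.
have compY (B : 'M[{poly F}]_c) i : (comp B *m Y) i 0 = lincomb M (B i).
  by rewrite mxE; apply: eq_bigr => j _; rewrite !mxE.
exists C => i j.
have powC s k : g ^+ e %| (comp (C ^+ s) *m Y - 'X^s *: Y) k 0.
  elim: s k => [|s IHs] k.
    by rewrite !expr0 scale1r /comp map_mx1 mul1mx subrr mxE dvdp0.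
  set D := _ - _ in IHs.
  have -> : comp (C ^+ s.+1) *m Y - 'X^(s.+1) *: Y =
      comp C *m D + 'X^s *: (comp C *m Y - 'X *: Y).
    rewrite exprS /comp map_mxM -mulmxA /D mulmxBr -scalemxAr scalerBr.
    by rewrite scalerA -exprSr addrA subrK.
  rewrite mxE dvdp_addl.
    rewrite mxE; apply: dvdp_sum => k'; exact: dvdp_mull.
  rewrite mxE dvdp_mull // mxE compY !mxE -exprS.
  suff -> : lincomb M (C k) = lincomb M (P k) by exact: PE.
  by apply: eq_bigr => k' _; rewrite mxE.
apply: (lincomb_dvd (p := (C ^+ M - 'X%:M) i) nzM irr_f f0 irr_g gf deg_g).
rewrite -compY /comp map_mxB mulmxBl map_scalar_mx /= comp_polyX mul_scalar_mx.
exact: powC.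
Qed.

(** * Gluing root matrices *)

Lemma exprD_orthogonal (R : pzRingType) (A B : R) m :
  A * B = 0 -> B * A = 0 -> (0 < m)%N -> (A + B) ^+ m = A ^+ m + B ^+ m.
Proof.
move=> AB BA; case: m => // m _; elim: m => [|m IHm]; first by rewrite !expr1.
rewrite exprSr IHm mulrDl !mulrDr -!exprSr.
by rewrite [A ^+ m.+1]exprSr -[A ^+ m * A * B]mulrA AB mulr0 addr0
  [B ^+ m.+1 as X in X * A]exprSr -mulrA BA mulr0 add0r.
Qed.

(** The rows of J are the basis vectors selected by iota, so J^T C J is
    the c x c matrix C placed at the indices in the image of iota. *)
Lemma selection_mul_trmx (R : comNzRingType) N c (iota : 'I_c -> 'I_N) :
  injective iota ->
  let J := rowsub iota (1%:M : 'M[R]_N) in J *m J^T = 1%:M.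
Proof.
move=> inj_iota J; rewrite -rowsubE; apply/matrixP => i j.
by rewrite !mxE (inj_eq inj_iota) eq_sym.
Qed.

Lemma selection_conj_exp (R : comNzRingType) N c
    (J : 'M[R]_(c, N)) (C : 'M_c) m :
  J *m J^T = 1%:M -> (0 < m)%N ->
  (J^T *m C *m J) ^+ m = J^T *m (C ^+ m) *m J.
Proof.
move=> JJ; case: m => // m _; elim: m => [|m IHm]; first by rewrite !expr1.
have -> : C ^+ m.+2 = C ^+ m.+1 *m C by rewrite exprSr.
rewrite exprSr IHm -[LHS]/(_ *m _) !mulmxA.
by congr (_ *m _ *m _); rewrite -!mulmxA JJ mulmx1.
Qed.

(** x times the projection onto the coordinates in P: the value required of S^M
    while only the coordinates in P have been treated. *)
Definition diagX (F : fieldType) N (P : {set 'I_N}) : 'M[{poly F}]_N :=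
  \matrix_(i, j) (if (i == j) && (i \in P) then 'X else 0).

Lemma diagX_split (F : fieldType) N c (iota : 'I_c -> 'I_N) (P : {set 'I_N}) :
  injective iota -> (forall k, iota k \in P) ->
  let J := rowsub iota (1%:M : 'M[{poly F}]_N) in
  diagX F P = diagX F (P :\: [set iota k | k : 'I_c]) + J^T *m 'X%:M *m J.
Proof.
move=> inj_iota P_iota J; apply/matrixP => i j.
rewrite mul_mx_scalar -scalemxAl !mxE inE.
have [/imsetP[k _ ->]|ni] /= := boolP (i \in [set iota k | k : 'I_c]).
  rewrite P_iota andbT andbF add0r (bigD1 k) //= big1 ?addr0 => [|k' nk].
    by rewrite !mxE eqxx mul1r; case: eqP; rewrite ?mulr1 ?mulr0.
  by rewrite !mxE (inj_eq inj_iota) (negPf nk) mul0r.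
rewrite big1 ?mulr0 ?addr0 // => k _; rewrite !mxE.
by case: eqP ni => [<-|_ _]; rewrite ?imset_f ?mul0r.
Qed.

(** Indices with the same key have the same modulus H, and their number is a
    multiple of the block size c, so they can be partitioned into blocks of
    size c. Each block receives a c x c root of x; distinct blocks act on
    disjoint coordinates, so the M-th power is taken block by block. *)
Lemma block_root_matrix (F : fieldType) (T : eqType) (M N : nat)
    (key : 'I_N -> T) (H : T -> {poly F}) (c : T -> nat) :
  (0 < M)%N -> (forall k, (0 < c k)%N) ->
  (forall i, c (key i) %| #|[set j | key j == key i]|)%N ->
  (forall k, exists C : 'M[{poly F}]_(c k),
     forall i j, H k %| (C ^+ M - 'X%:M) i j) ->
  exists2 S : 'M[{poly F}]_N,
    forall i j, key i != key j -> S i j = 0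
  & forall i j, H (key j) %| (S ^+ M - 'X%:M) i j.
Proof.
move=> M_gt0 c_gt0 c_dvd rootC.
(* The blocks are split off one at a time: P is the set of indices already
   covered by S. *)
suff good (P : {set 'I_N}) :
    (forall i, i \in P -> c (key i) %| #|[set j in P | key j == key i]|)%N ->
    exists S : 'M[{poly F}]_N,
    [/\ forall i j, (i \notin P) || (j \notin P) -> S i j = 0,
        forall i j, key i != key j -> S i j = 0
      & forall i j, H (key j) %| (S ^+ M - diagX F P) i j].
  have [|S [_ keyS rootS]] := good setT.
    move=> i _; have := c_dvd i; congr (_ %| _)%N.
    by apply: eq_card => j; rewrite !inE.
  exists S => // i j; suff -> : 'X%:M = diagX F [set: 'I_N] by [].
  by apply/matrixP => k l; rewrite !mxE inE andbT; case: eqP.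
have [n] := ubnP #|P|; elim: n P => // n IHn P le_Pn dvdP.
have [P0|[i0 i0P]] := set_0Vmem P.
  exists 0; split=> // [i j _|i j _|i j]; rewrite ?mxE //.
  rewrite expr0n eqn0Ngt M_gt0 /= !mxE P0 inE andbF subrr.
  exact: dvdp0.
(* A new block: c indices with the same key as i0, listed by iota. *)
set B := [set j in P | key j == key i0].
have le_cB : (c (key i0) <= #|B|)%N.
  by rewrite dvdn_leq ?dvdP // (cardD1 i0) inE i0P eqxx.
pose iota k : 'I_N := enum_val (widen_ord le_cB k).
have inj_iota : injective iota.
  by move=> k k' /enum_val_inj/(congr1 val)/= /val_inj.
have iotaP k : iota k \in P /\ key (iota k) = key i0.
  by have := enum_valP (widen_ord le_cB k); rewrite inE => /andP[? /eqP].
set P' := P :\: [set iota k | k : 'I_(c (key i0))].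
have [||S [supS keyS rootS]] := IHn P'.
- rewrite -ltnS (leq_trans _ le_Pn) // ltnS proper_card //.
  rewrite properEneq subsetDl andbT.
  apply/negP => /eqP P'P; have := (iotaP (Ordinal (c_gt0 (key i0)))).1.
  by rewrite -P'P inE imset_f.
- move=> i; rewrite inE => /andP[_ iP].
  have [ki|nki] := eqVneq (key i) (key i0); last first.
    suff -> : #|[set j in P' | key j == key i]| =
              #|[set j in P | key j == key i]|.
      exact: dvdP.
    apply: eq_card => j; rewrite !inE.
    have [kj|] := eqVneq (key j) (key i); rewrite ?andbT ?andbF //.
    rewrite andb_idl // => _; apply/imsetP => -[k _ jk].
    by move: nki; rewrite -kj jk (iotaP k).2 eqxx.
  rewrite ki.
  have -> : [set j in P' | key j == key i0] =
      B :\: [set iota k | k : 'I_(c (key i0))].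
    by apply/setP => j; rewrite !inE andbA.
  rewrite cardsD (setIidPr _); last first.
    apply/subsetP => _ /imsetP[k _ ->].
    by rewrite inE (iotaP k).1 (iotaP k).2 eqxx.
  by rewrite card_imset // card_ord dvdn_sub // dvdP.
have [C rootC0] := rootC (key i0).
pose J := rowsub iota (1%:M : 'M[{poly F}]_N).
have JJ : J *m J^T = 1%:M by apply: selection_mul_trmx.
have JE k j : J k j = (iota k == j)%:R by rewrite !mxE.
have SJ : S *m J^T = 0.
  apply/matrixP => i k; rewrite -[S]trmxK -trmx_mul -rowsubE !mxE supS //.
  by rewrite [iota k \in _]inE imset_f ?orbT.
have JS : J *m S = 0.
  by apply/matrixP => k i; rewrite -rowsubE !mxE supS // inE imset_f.
pose B' := J^T *m C *m J.
have SB : S * B' = 0 by rewrite -[LHS]/(_ *m _) !mulmxA SJ !mul0mx.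
have BS : B' * S = 0 by rewrite -[LHS]/(_ *m _) -!mulmxA JS !mulmx0.
exists (S + B'); split=> [i j ij|i j kij|i j].
- rewrite mxE supS; last first.
    by case/orP: ij => nP; rewrite !inE (negPf nP) !andbF ?orbT.
  rewrite add0r; case/orP: ij => nP.
    rewrite /B' -mulmxA mxE big1 // => k _; rewrite mxE JE.
    by case: eqP nP => [<-|_ _]; rewrite ?mul0r ?(iotaP _).1.
  rewrite mxE big1 // => k _; rewrite JE.
  by case: eqP nP => [<-|_ _]; rewrite ?mulr0 ?(iotaP _).1.
- rewrite mxE keyS // add0r mxE big1 // => k _; rewrite JE mxE.
  have [kj|_] := eqVneq (iota k) j; last by rewrite mulr0.
  rewrite mulr1 big1 // => k' _; rewrite mxE JE.
  have [k'i|_] := eqVneq (iota k') i; last by rewrite mul0r.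
  by move: kij; rewrite -kj -k'i !(iotaP _).2 eqxx.
rewrite exprD_orthogonal // selection_conj_exp //.
rewrite (diagX_split F inj_iota) => [|k]; last exact: (iotaP k).1.
rewrite -/P' -/J opprD addrACA -mulmxBl -mulmxBr mxE dvdp_add //.
rewrite mxE; apply: dvdp_sum => k.
rewrite JE; have [kj|_] := eqVneq (iota k) j; last by rewrite mulr0 dvdp0.
rewrite mulr1 -kj (iotaP k).2 mxE; apply: dvdp_sum => k'.
by rewrite dvdp_mull.
Qed.

(** * From matrices of polynomials to endomorphisms *)

Lemma mk_monicE (F : fieldType) (h : {poly F}) :
  h \is monic -> (1 < size h)%N -> mk_monic h = h.
Proof. by rewrite /mk_monic => -> ->. Qed.

Lemma in_qpoly_eq (F : fieldType) (h p q : {poly F}) :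
  h \is monic -> (1 < size h)%N ->
  (in_qpoly h p == in_qpoly h q) = (h %| p - q).
Proof.
move=> mon_h h_gt1; rewrite -subr_eq0 -raddfB -val_eqE /=.
by rewrite mk_monicE // -Pdiv.IdomainMonic.modpE.
Qed.

Lemma in_qpolyK (F : fieldType) (h : {poly F}) (z : {poly %/ h}) :
  in_qpoly h z = z.
Proof. by apply/val_inj/in_qpoly_small/size_mk_monic. Qed.

Lemma linear_matrix (F : fieldType) n (g : 'cV[F]_n -> 'cV[F]_n) :
  (forall u v, g (u + v) = g u + g v) -> (forall a u, g (a *: u) = a *: g u) ->
  exists B : 'M[F]_n, forall u, g u = B *m u.
Proof.
move=> gD gZ; exists (\matrix_(i, j) g (delta_mx j 0) i 0) => u.
have g0 : g 0 = 0 by have := gZ 0 0; rewrite !scale0r.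
apply/colP => i; rewrite [in LHS](matrix_sum_delta u).
rewrite (big_morph g gD g0) summxE mxE; apply: eq_bigr => j _.
by rewrite big_ord1 gZ !mxE mulrC.
Qed.

(** S acts on the direct sum of the F[x]/(h k) because it only mixes summands
    with the same modulus: this is what makes multiplication by S compatible
    with the congruences. Transported to F^n, the action is the matrix X. *)
Lemma polymod_root (F : fieldType) n (A : 'M[F]_n.+1) (K : finType)
    (h : K -> {poly F})
    (phi : 'cV[F]_n.+1 -> {dffun forall k : K, {poly %/ h k}})
    (M : nat) (S : 'M[{poly F}]_#|K|) :
  (forall k, h k \is monic) -> (forall k, 1 < size (h k))%N ->
  polymod_isom A phi ->
  (forall i j : 'I_#|K|, h (enum_val i) != h (enum_val j) -> S i j = 0) ->
  (forall i j : 'I_#|K|, h (enum_val j) %| (S ^+ M - 'X%:M) i j) ->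
  exists X : 'M[F]_n.+1, X ^+ M = A.
Proof.
move=> mon_h h_gt1 [[psi phiK psiK] phiD phiM] blockS rootS.
pose hh (i : 'I_#|K|) := h (enum_val i).
have inE_hh i p q :
    (in_qpoly (hh i) p == in_qpoly (hh i) q) = (hh i %| p - q).
  by apply: in_qpoly_eq; [apply: mon_h | apply: h_gt1].
(* w u lists representatives of the coordinates of u, which matter only up to
   the congruence eqm modulo the h k. *)
pose w u : 'rV[{poly F}]_#|K| := \row_i (phi u (enum_val i) : {poly F}).
pose eqm (P Q : 'rV[{poly F}]_#|K|) := forall i, hh i %| P 0 i - Q 0 i.
have eqm_trans P Q R : eqm P Q -> eqm Q R -> eqm P R.
  by move=> PQ QR i; rewrite -(subrK (Q 0 i) (P 0 i)) -addrA dvdp_add.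
have eqm_sym P Q : eqm P Q -> eqm Q P.
  by move=> PQ i; rewrite -opprB dvdpNr.
have eqmD P Q P' Q' : eqm P Q -> eqm P' Q' -> eqm (P + P') (Q + Q').
  by move=> PQ PQ' i; rewrite !mxE opprD addrACA dvdp_add.
have eqmZ a P Q : eqm P Q -> eqm (a *: P) (a *: Q).
  by move=> PQ i; rewrite !mxE -mulrBr dvdp_mull.
have eqmS P Q : eqm P Q -> eqm (P *m S) (Q *m S).
  move=> PQ i; rewrite !mxE -sumrB; apply: dvdp_sum => k.
  rewrite -mulrBl; have [hki|nhki] := eqVneq (hh k) (hh i).
    by rewrite -hki dvdp_mulr.
  by rewrite blockS // mulr0 dvdp0.
have w_inj u v : eqm (w u) (w v) -> u = v.
  move=> uv; apply: (can_inj phiK); apply/ffunP => k; apply/eqP.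
  rewrite -[phi u k]in_qpolyK -[phi v k]in_qpolyK in_qpoly_eq //.
  by have := uv (enum_rank k); rewrite /hh !mxE enum_rankK.
have wD u v : eqm (w (u + v)) (w u + w v).
  by move=> i; rewrite !mxE phiD -inE_hh in_qpolyD !in_qpolyK.
have wM p u : eqm (w (horner_mx A p *m u)) (p *: w u).
  by move=> i; rewrite !mxE phiM -inE_hh in_qpolyM !in_qpolyK.
pose act u :=
  psi (finfun (fun k => in_qpoly (h k) ((w u *m S) 0 (enum_rank k)))).
have wact u : eqm (w (act u)) (w u *m S).
  by move=> i; rewrite mxE psiK ffunE -inE_hh in_qpolyK enum_valK.
have [X actE] : exists X : 'M[F]_n.+1, forall u, act u = X *m u.
  apply: linear_matrix => [u v|a u]; apply: (w_inj);
    apply: (eqm_trans _ _ _ (wact _) _).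
    apply: (eqm_trans _ _ _ (eqmS _ _ (wD _ _)) _); rewrite mulmxDl.
    apply: (eqm_sym); apply: (eqm_trans _ _ _ (wD _ _) _).
    by apply: (eqmD); apply: wact.
  have wZ b v : eqm (w (b *: v)) (b%:P *: w v).
    by have := wM b%:P v; rewrite horner_mx_C mul_scalar_mx.
  apply: (eqm_trans _ _ _ (eqmS _ _ (wZ _ _)) _); rewrite -scalemxAl.
  apply: (eqm_sym); apply: (eqm_trans _ _ _ (wZ _ _) _).
  by apply: (eqmZ); apply: wact.
have wX m u : eqm (w (X ^+ m *m u)) (w u *m S ^+ m).
  elim: m => [|m IHm].
    by rewrite !expr0 mul1mx mulmx1 => i; rewrite subrr dvdp0.
  rewrite exprS exprSr -mulmxA -actE mulmxA.
  exact: eqm_trans _ _ _ (wact _) (eqmS _ _ IHm).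
have XA (u : 'cV[F]_n.+1) : X ^+ M *m u = A *m u.
  apply: (w_inj); apply: (eqm_trans _ _ _ (wX M u) _); apply: (eqm_sym).
  have := wM 'X u; rewrite horner_mx_X => wAu; apply: (eqm_trans _ _ _ wAu _).
  rewrite -mul_mx_scalar => i.
  rewrite -opprB dvdpNr -[X in _ %| X - _]/((w u *m S ^+ M) 0 i).
  have -> : (w u *m S ^+ M) 0 i - (w u *m 'X%:M) 0 i =
      (w u *m (S ^+ M - 'X%:M)) 0 i by rewrite mulmxBr !mxE.
  rewrite mxE; apply: dvdp_sum => k.
  exact: dvdp_mull (rootS k i).
exists X; apply/matrixP => i j.
by have /colP/(_ i) := XA (delta_mx j 0); rewrite -!colE !mxE.
Qed.

(** * Dimensions of kernels *)

(** With t the gcd of q and h, the annihilator of q in F[x]/(h) consists of the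
    multiples of h / t, and is parametrized by polynomials of size at most
    deg t. *)
Lemma card_qpoly_annihilator (F : finFieldType) (h q : {poly F}) :
  h \is monic -> (1 < size h)%N ->
  #|[pred z : {poly %/ h} | h %| q * z]| = (#|F| ^ deg (gcdp q h))%N.
Proof.
move=> mon_h h_gt1; set t := gcdp q h.
have nz_h := monic_neq0 mon_h.
have nz_t : t != 0 by rewrite gcdp_eq0 (negPf nz_h) andbF.
have hE := divpK (dvdp_gcdr q h); have qE := divpK (dvdp_gcdl q h).
rewrite -/t in hE qE; set h1 := h %/ t in hE; set q1 := q %/ t in qE.
have nz_h1 : h1 != 0 by apply: contraNneq nz_h => h10; rewrite -hE h10 mul0r.
have co : coprimep h1 q1.
  by rewrite coprimep_sym coprimep_div_gcd // nz_h orbT.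
have size_h : size h = (size h1 + deg t)%N.
  rewrite -hE size_mul // /deg.
  by case: (size t) (size_poly_gt0 t) => [|m _]; rewrite ?nz_t //= addnS.
pose theta (y : {poly_(deg t) F}) := in_qpoly h (h1 * y).
have thetaE y : theta y = h1 * y :> {poly F}.
  rewrite in_qpoly_small // mk_monicE // size_h.
  have [->|nz_y] := eqVneq (y : {poly F}) 0.
    by rewrite mulr0 size_poly0 addn_gt0 size_poly_gt0 nz_h1.
  rewrite size_mul //.
  have := size_npoly y; have : (0 < size h1)%N by rewrite size_poly_gt0.
  by case: (size h1) => // m _ le_y; rewrite addSn /= ltnS leq_add2l.
have theta_inj : injective theta.
  move=> y y' eq_th; apply/val_inj/(mulfI nz_h1).
  by have := thetaE y; rewrite eq_th thetaE => ->.
rewrite -card_npoly -(card_codom theta_inj); apply: eq_card => z; rewrite !inE.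
have -> : (h %| q * z) = (h1 %| z).
  by rewrite -{1}hE -{1}qE mulrAC dvdp_mul2r // Gauss_dvdpr.
apply/idP/codomP => [hz|[y ->]]; last by rewrite thetaE dvdp_mulr.
have le_y : (size ((z : {poly F}) %/ h1)%R <= deg t)%N.
  rewrite size_divp //.
  have : (size (z : {poly F}) < size h)%N.
    by rewrite (leq_trans (size_mk_monic z)) // mk_monicE.
  rewrite size_h.
  case: (size h1) (size_poly_gt0 h1) => [|m _]; rewrite ?nz_h1 //=.
  by rewrite addSn ltnS leq_subLR.
exists (NPoly le_y); apply: val_inj; rewrite [RHS]thetaE /=.
by rewrite mulrC divpK.
Qed.

Lemma card_ker (F : finFieldType) n (B : 'M[F]_n) :
  #|[pred u : 'cV[F]_n | B *m u == 0]| = (#|F| ^ (n - \rank B))%N.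
Proof.
rewrite -mxrank_tr -mxrank_ker -card_rowg.
rewrite -(card_imset _ (can_inj (@trmxK F n 1))); apply: eq_card => u.
rewrite mem_rowg sub_kermx; apply/imsetP/idP => [[v]|uB].
  by rewrite inE => /eqP Bv ->; rewrite -trmx_mul Bv trmx0.
exists u^T; rewrite ?trmxK // inE -[B]trmxK -trmx_mul (eqP uB) trmx0.
exact: eqxx.
Qed.

(** The kernel of q(A) is the direct sum of the annihilators of q in the
    summands; comparing cardinalities gives its dimension. *)
Lemma corank_polymod (F : finFieldType) n (A : 'M[F]_n.+1) (K : finType)
    (h : K -> {poly F})
    (phi : 'cV[F]_n.+1 -> {dffun forall k : K, {poly %/ h k}})
    (q : {poly F}) :
  (forall k, h k \is monic) -> (forall k, 1 < size (h k))%N ->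
  polymod_isom A phi ->
  (n.+1 - \rank (horner_mx A q) = \sum_k deg (gcdp q (h k)))%N.
Proof.
move=> mon_h h_gt1 [[psi phiK psiK] phiD phiM].
have /expnI : (1 < #|F|)%N by exact: finNzRing_gt1.
apply; rewrite -card_ker.
have phi0 k : phi 0 k = 0.
  by apply: (addrI (phi 0 k)); rewrite -phiD !addr0.
pose Fam k : pred {poly %/ h k} := [pred z : {poly %/ h k} | h k %| q * z].
pose Q k : finType := {poly %/ h k}.
transitivity #|(family (Fam : forall k, pred (Q k))
                  : simpl_pred {dffun forall k : K, Q k})|.
  rewrite -(card_image (can_inj psiK)); apply: eq_card => u.
  have FamE : (horner_mx A q *m u == 0) = (phi u \in family Fam).
    rewrite -(inj_eq (can_inj phiK)); apply/eqP/familyP => [qu k|qu].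
      have := phiM q u k; rewrite qu phi0 -[phi u k in RHS]in_qpolyK -in_qpolyM.
      by rewrite -(in_qpoly0 (h k)) => /esym/eqP; rewrite in_qpoly_eq // subr0.
    apply/ffunP => k; rewrite phi0 phiM -[phi u k]in_qpolyK -in_qpolyM.
    apply/eqP; rewrite -(in_qpoly0 (h k)) in_qpoly_eq // subr0.
    exact: qu.
  rewrite inE FamE; apply/idP/imageP => [uF|[z zF ->]]; last by rewrite psiK.
  by exists (phi u); rewrite ?phiK.
rewrite card_family foldrE big_image expn_sum /=; apply: eq_bigr => k _.
exact: card_qpoly_annihilator.
Qed.

(** Over F[x], the matrix x - A divides p(x) - p(A), which is the scalar matrix
    p when p(A) = 0; take determinants. *)
Lemma char_poly_dvd_exp (F : fieldType) n (A : 'M[F]_n.+1) (p : {poly F}) :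
  horner_mx A p = 0 -> char_poly A %| p ^+ n.+1.
Proof.
move=> pA; have [B] : exists B : 'M[{poly F}]_n.+1,
    p%:M - map_mx polyC (horner_mx A p) = char_poly_mx A *m B.
  elim/poly_ind: p {pA} => [|p c [B IHp]].
    by exists 0; rewrite mulmx0 !rmorph0 subr0.
  exists ('X *: B + map_mx polyC (horner_mx A p)).
  have -> : horner_mx A (p * 'X + c%:P) = A *m horner_mx A p + c%:M.
    by rewrite rmorphD mulrC rmorphM /= horner_mx_X horner_mx_C.
  rewrite mulmxDr -scalemxAr -IHp map_mxD map_mxM map_scalar_mx /=.
  rewrite mulmxBl mul_scalar_mx scalerBr scale_scalar_mx [_ * p]mulrC.
  by rewrite subrKA raddfD /= opprD addrACA subrr addr0.
rewrite pA map_mx0 subr0 => /(congr1 determinant).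
by rewrite det_scalar det_mulmx => ->; rewrite dvdp_mulr.
Qed.

(** The restriction of X to the kernel of p(X) is annihilated by p, so the
    irreducible factors of its characteristic polynomial divide p. The dimension
    of the kernel is the degree of this characteristic polynomial. *)
Lemma dvdn_corank (F : finFieldType) n (X : 'M[F]_n.+1) (p : {poly F}) D :
  (forall g, g \is monic -> irreducible_poly g -> g %| p -> (D %| deg g)%N) ->
  (D %| n.+1 - \rank (horner_mx X p))%N.
Proof.
move=> D_p; rewrite -mxrank_ker.
set W := kermx _.
have W_stable : stablemx W X by apply/comm_mx_stable_ker/comm_horner_mx.
have : row_base W *m horner_mx X p = 0.
  by apply/eqP; rewrite -sub_kermx eq_row_base.
have : stablemx (row_base W) X by rewrite stablemx_row_base.
have := row_base_free W.
move: (row_base W); case: (\rank W) => [|m] V free_V V_stable Vp.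
  exact: dvdn0.
(* conjmx V X is the matrix of X restricted to the kernel of p(X). *)
have pS : horner_mx (conjmx V X) p = 0.
  by rewrite horner_mx_conj // /conjmx Vp mul0mx.
have degE : deg (char_poly (conjmx V X)) = m.+1 by rewrite /deg size_char_poly.
rewrite -degE.
apply: dvdn_deg_factors (char_poly_monic _) _ => g mon_g irr_g gS.
apply: D_p => //; apply: irreducible_dvd_exp (m.+1) irr_g _.
by rewrite (dvdp_trans gS) // char_poly_dvd_exp.
Qed.

Lemma horner_mxXn (F : fieldType) n (X : 'M[F]_n.+1) M (q : {poly F}) :
  horner_mx (X ^+ M) q = horner_mx X (q \Po 'X^M).
Proof.
elim/poly_ind: q => [|p c IHp]; first by rewrite comp_poly0 !rmorph0.
rewrite comp_polyD comp_polyM comp_polyX comp_polyC !rmorphD !rmorphM /= IHp.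
by rewrite rmorphXn /= !horner_mx_X !horner_mx_C.
Qed.

(** * Exponents and parts of partitions *)

Lemma deg_exp (F : fieldType) (f : {poly F}) e : deg (f ^+ e) = (deg f * e)%N.
Proof. exact: size_exp. Qed.

Lemma deg_gcd_exp (F : fieldType) (f : {poly F}) i j :
  deg (gcdp (f ^+ i) (f ^+ j)) = (deg f * minn i j)%N.
Proof.
have [le_ij|/ltnW le_ji] := leqP i j.
  by rewrite -deg_exp /deg (eqp_size (dvdp_gcd_idl _)) // dvdp_exp2l.
by rewrite -deg_exp /deg (eqp_size (dvdp_gcd_idr _)) // dvdp_exp2l.
Qed.

Lemma deg_gcd_coprime_exp (F : fieldType) (f g : {poly F}) i j :
  coprimep f g -> deg (gcdp (f ^+ i) (g ^+ j)) = 0%N.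
Proof.
move=> co; have : coprimep (f ^+ i) (g ^+ j).
  by rewrite coprimep_expl ?coprimep_expr.
by rewrite /coprimep /deg => /eqP->.
Qed.

(** Sums over the summands of the module become sums over the parts of the
    partitions. *)
Lemma sum_parts l (lam : 'I_l -> seq nat) (G : 'I_l -> nat -> nat) :
  (\sum_(k : {i : 'I_l & 'I_(size (lam i))})
     G (tag k) (nth 0 (lam (tag k)) (tagged k)) =
   \sum_i \sum_(e <- lam i) G i e)%N.
Proof.
rewrite -(sig_big_dep xpredT (fun _ _ => true)
  (fun i (j : 'I_(size (lam i))) => G i (nth 0%N (lam i) j))) /=.
by apply: eq_bigr => i _; rewrite [RHS](big_nth 0%N) big_mkord.
Qed.

Lemma moduli_monic_nonconst (F : fieldType) l (f : 'I_l -> {poly F})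
    (lam : 'I_l -> seq nat) :
  (forall i, in_Phi (f i)) ->
  (forall i, is_partition (lam i) /\ lam i <> [::]) ->
  forall k : {i : 'I_l & 'I_(size (lam i))},
  f (tag k) ^+ nth 0%N (lam (tag k)) (tagged k) \is monic /\
  (1 < size (f (tag k) ^+ nth 0%N (lam (tag k)) (tagged k))%R)%N.
Proof.
move=> Phi_f part_lam k; set e := nth _ _ _.
have [mon_f [f_gt1 _] _] := Phi_f (tag k).
have mon_h : f (tag k) ^+ e \is monic by rewrite monic_exp.
split=> //; rewrite -[size _]prednK ?size_poly_gt0 ?monic_neq0 // ltnS.
rewrite size_exp muln_gt0 -subn1 subn_gt0 f_gt1 /=.
have [/andP[_ /allP pos] _] := part_lam (tag k).
by apply: pos; rewrite mem_nth.
Qed.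

(** The sum of min(j, e) over the parts e grows, from j to j + 1, by the number
    of parts above j; and the number of parts above j drops, from j to j + 1, by
    the number of parts equal to j + 1. *)
Lemma dvdn_mult_parts (c : nat) (lam : seq nat) :
  (forall j, c %| \sum_(e <- lam) minn j e)%N -> all (fun e => 0 < e)%N lam ->
  forall j, (c %| mult j lam)%N.
Proof.
move=> c_min pos j.
have c_gt i : (c %| count (fun e => i < e) lam)%N.
  have := c_min i.+1.
  suff -> : (\sum_(e <- lam) minn i.+1 e =
             \sum_(e <- lam) minn i e + count (fun e => i < e) lam)%N.
    by rewrite dvdn_addr.
  rewrite -sum1_count [X in (_ + X)%N]big_mkcond -big_split.
  apply: eq_bigr => e _ /=.
  by case: ifP => ie; lia.
case: j => [|j].
  suff -> : mult 0 lam = 0%N by [].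
  by apply/count_memPn; apply/negP => /(allP pos).
suff multE : (count (fun e => j < e) lam =
              mult j.+1 lam + count (fun e => j.+1 < e) lam)%N.
  by have := c_gt j; rewrite multE dvdn_addl.
rewrite /mult -!sum1_count [LHS]big_mkcond [X in (X + _)%N]big_mkcond.
rewrite [X in (_ + X)%N]big_mkcond -big_split; apply: eq_bigr => e _ /=.
by do 3!case: ifP => ?; lia.
Qed.

(** * The two implications *)

Lemma power_necessary (F : finFieldType) (r a n : nat) (alpha : {'GL_n[F]})
    (l : nat) (f : 'I_l -> {poly F}) (lam : 'I_l -> seq nat) :
  prime r -> coprime #|F| (r ^ a)%N -> combinatorial_data alpha f lam ->
  (exists X : {'GL_n[F]}, (X ^+ (r ^ a))%g = alpha) ->
  forall i, in_Phi_pow (r ^ a) (f i) \/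
     exists b, [/\ (1 <= b <= a)%N, in_Phi_split r a b (f i)
              & forall j : nat, (r ^ b %| mult j (lam i))%N].
Proof.
move=> r_prime coprime_qM [inj_f Phi_f part_lam _ [phi phi_isom]].
set A := GLval alpha in phi_isom.
set M := (r ^ a)%N in coprime_qM *.
pose part (k : {i : 'I_l & 'I_(size (lam i))}) :=
  nth 0%N (lam (tag k)) (tagged k).
pose h k := f (tag k) ^+ part k.
have mon_h k : h k \is monic := (moduli_monic_nonconst Phi_f part_lam k).1.
have h_gt1 k : (1 < size (h k))%N := (moduli_monic_nonconst Phi_f part_lam k).2.
case=> X XA i.
have [|[b [ab split_b]]] := power_or_split r_prime coprime_qM (Phi_f i).
  by left.
right; exists b; split=> //; apply: dvdn_mult_parts; last first.
  by have [/andP[]] := part_lam i.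
move=> j; have [_ [s [_ sP _ deg_s]]] := split_b.
have AE : A = GLval X ^+ M by rewrite /A -XA FinRing.val_unitX.
have := corank_polymod (f i ^+ j) mon_h h_gt1 phi_isom.
rewrite AE horner_mxXn => rankE.
have : (r ^ b * deg (f i) %|
    n.-1.+1 - \rank (horner_mx (GLval X) ((f i ^+ j) \Po 'X^M)))%N.
  apply: dvdn_corank => g mon_g irr_g; rewrite rmorphXn /=.
  move=> /(irreducible_dvd_exp irr_g) gf.
  have gs : g \in s by apply: (sP g).2.
  by rewrite (deg_s g gs).
rewrite rankE (sum_parts _ (fun i' e => deg (gcdp (f i ^+ j) (f i' ^+ e)))).
rewrite (bigD1 i) //= [X in (_ + X)%N]big1 ?addn0 => [|i' ne_i].
  rewrite (eq_bigr (fun e => minn j e * deg (f i))%N) => [|e _].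
    have [_ irr_f _] := Phi_f i.
    by rewrite -big_distrl /= dvdn_pmul2r ?irreducible_deg_gt0.
  by rewrite deg_gcd_exp mulnC.
rewrite big1 // => e _; apply: deg_gcd_coprime_exp.
have [mon_i irr_i _] := Phi_f i; have [mon_i' irr_i' _] := Phi_f i'.
rewrite irreducible_poly_coprime //; apply: contra ne_i => fif.
by apply/eqP/inj_f/esym/monic_irreducible_eq.
Qed.

(** The summands are indexed by ordinals through enum_val, and the key of a
    summand F[x]/(f_i^e) is the pair (i, e); the summands with this key number
    m_e(lambda_i), a multiple of c i. *)
Lemma power_sufficient (F : finFieldType) (r a n : nat) (alpha : {'GL_n[F]})
    (l : nat) (f : 'I_l -> {poly F}) (lam : 'I_l -> seq nat) :
  prime r -> coprime #|F| (r ^ a)%N -> combinatorial_data alpha f lam ->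
  (forall i, in_Phi_pow (r ^ a) (f i) \/
     exists b, [/\ (1 <= b <= a)%N, in_Phi_split r a b (f i)
              & forall j : nat, (r ^ b %| mult j (lam i))%N]) ->
  exists X : {'GL_n[F]}, (X ^+ (r ^ a))%g = alpha.
Proof.
move=> r_prime coprime_qM [_ Phi_f part_lam _ [phi phi_isom]].
set A := GLval alpha in phi_isom.
set M := (r ^ a)%N in coprime_qM *.
have M_gt0 : (0 < M)%N by rewrite expn_gt0 prime_gt0.
pose part (k : {i : 'I_l & 'I_(size (lam i))}) :=
  nth 0%N (lam (tag k)) (tagged k).
pose h k := f (tag k) ^+ part k.
have mon_h k : h k \is monic := (moduli_monic_nonconst Phi_f part_lam k).1.
have h_gt1 k : (1 < size (h k))%N := (moduli_monic_nonconst Phi_f part_lam k).2.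
move=> cases.
(* Membership in Phi^M gives c = 1, membership in Phi_(M,b) gives c = r^b. *)
have rootE i : exists c, [/\ (0 < c)%N, forall j, (c %| mult j (lam i))%N &
    exists g, [/\ irreducible_poly g, g %| f i \Po 'X^M
                & deg g = (c * deg (f i))%N]].
  have [[_ [g [irr_g gf deg_g]]]|
        [b [_ [_ [s [_ sP size_s deg_s]]] dvd_b]]] := cases i.
    by exists 1%N; split=> //; exists g; rewrite mul1n.
  exists (r ^ b)%N; split; rewrite ?expn_gt0 ?prime_gt0 //.
  case: s => [|g s] in sP size_s deg_s.
    by move: size_s => /esym/eqP; rewrite expn_eq0 gtn_eqF // prime_gt0.
  exists g; have [_ irr_g gf] := (sP g).1 (mem_head _ _).
  by split=> //; apply: deg_s; rewrite mem_head.
have [c cP] := fin_all_exists rootE.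
pose K := {i : 'I_l & 'I_(size (lam i))}.
pose key (x : 'I_#|{: K}|) := (tag (enum_val x), part (enum_val x)).
pose H (p : 'I_l * nat) := f p.1 ^+ p.2.
have [||p|S blockS rootS] :=
  @block_root_matrix F _ M _ key H (fun p => c p.1) M_gt0.
- by move=> p; have [] := cP p.1.
- move=> x /=; have [_ dvd_c _] := cP (tag (enum_val x)).
  suff -> : #|[set y | key y == key x]| = mult (key x).2 (lam (key x).1).
    exact: dvd_c.
  transitivity (\sum_y (key y == key x : nat))%N.
    rewrite -sum1_card big_mkcond; apply: eq_bigr => y _.
    by rewrite inE; case: eqP.
  case: (key x) => i e /=.
  transitivity (\sum_(k : K) ((tag k, part k) == (i, e) : nat))%N.
    rewrite (reindex (enum_val : 'I_#|{: K}| -> K)) //.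
    exact/onW_bij/enum_val_bij.
  rewrite (sum_parts _ (fun i' e' => ((i', e') == (i, e)) : nat)).
  rewrite (bigD1 i) //= [X in (_ + X)%N]big1 ?addn0 => [|i' /negPf ne_i].
    rewrite /mult -sum1_count [RHS]big_mkcond; apply: eq_bigr => e' _.
    by rewrite xpair_eqE eqxx /=; case: eqP.
  by rewrite big1 // => e' _; rewrite xpair_eqE ne_i.
- have [_ _ [g [irr_g gf deg_g]]] := cP p.1.
  have [_ irr_f _] := Phi_f p.1.
  apply: (root_matrix _ (natr_neq0_coprime coprime_qM) irr_f) irr_g gf deg_g.
  exact: in_Phi_root0.
have [|X XA] := @polymod_root F _ A K h phi M S mon_h h_gt1 phi_isom _ rootS.
  move=> x y ne_h; apply: blockS; apply: contraNneq ne_h => eq_key.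
  by rewrite -[h _]/(H (key x)) eq_key.
have uX : X \is a GRing.unit.
  by rewrite -(unitrX_pos _ M_gt0) XA; apply: (valP alpha).
exists (FinRing.unit _ uX : {'GL_n[F]}); apply: val_inj.
by rewrite FinRing.val_unitX /= XA.
Qed.

Local Close Scope ring_scope.

Theorem proposition4p6 (F : finFieldType) (r a n : nat)
  (r_prime : prime r) (a_gt0 : 0 < a) (coprime_qM : coprime #|F| (r ^ a))
  (n_gt0 : 0 < n) (alpha : {'GL_n[F]})
  (l : nat) (f : 'I_l -> {poly F}) (lam : 'I_l -> seq nat)
  (Delta_alpha : combinatorial_data alpha f lam) :
  (exists X : {'GL_n[F]}, (X ^+ (r ^ a))%g = alpha) <->
  (forall i : 'I_l,
     in_Phi_pow (r ^ a) (f i) \/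
     (exists b : nat,
        [/\ 1 <= b <= a, in_Phi_split r a b (f i)
          & forall j : nat, r ^ b %| mult j (lam i)])).
Proof.
split; first exact: power_necessary Delta_alpha.
exact: power_sufficient Delta_alpha.
Qed.
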